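(* Let $A$ be a finite alphabet, $n\geq 1$, and $d:A^n\to A$ a block map. Then $d$ is left permutive if and only if the induced sliding block code $\tau_d:A^{\mathbb{N}}\to A^{\mathbb{N}}$ $*$-commutes with the shift map $\sigma:A^{\mathbb{N}}\to A^{\mathbb{N}}$.
   Context: $A^n$ denotes the set of words of length $n$ over $A$ and $A^{\mathbb{N}}$ the set of one-sided infinite sequences $x=x_1x_2x_3\cdots$ of elements of $A$. The shift is $\sigma(x_1x_2x_3\cdots)=x_2x_3\cdots$. A block map is a function $d:A^n\to A$; the induced sliding block code $\tau_d:A^{\mathbb{N}}\to A^{\mathbb{N}}$ is $\tau_d(x)_i=d(x_i\cdots x_{i+n-1})$ for $i\ge 1$. The block map $d$ is left permutive if for each fixed word $x_1\cdots x_{n-1}\in A^{n-1}$ the function $A\to A$, $a\mapsto d(ax_1\cdots x_{n-1})$, is bijective. $*$-commuting: for a set $X$ and commuting functions $S,T:X\to X$, we say $S$ and $T$ $*$-commute if for every $(y,z)\in X\times X$ with $S(y)=T(z)$ there exists a unique $x\in X$ such that $T(x)=y$ and $S(x)=z$. (So $*$-commuting includes $ST=TS$.) *)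

(* Defs.v *)
From mathcomp Require Import all_boot.

Set Implicit Arguments.
Unset Strict Implicit.
Unset Printing Implicit Defensive.

(* A one-sided sequence x_1 x_2 x_3 ... over A is a function x : nat -> A with *)
(* x i standing for x_(i+1).                                                  *)
Definition shift (A : Type) (x : nat -> A) : nat -> A := fun i => x i.+1.

Definition sliding_block_code (A : Type) (n : nat) (d : n.-tuple A -> A)
    (x : nat -> A) : nat -> A :=
  fun i => d [tuple x (i + j) | j < n].

(* Block maps of length at least 1 have domain n.+1.-tuple A; the fixed word  *)
(* w then has length n.                                                       *)
Definition left_permutive (A : Type) (n : nat) (d : n.+1.-tuple A -> A) : Prop :=
  forall w : n.-tuple A, bijective (fun a : A => d [tuple of a :: w]).

Definition star_commute (X : Type) (S T : X -> X) : Prop :=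
  S \o T =1 T \o S /\
  forall y z : X, S y = T z -> exists! x : X, T x = y /\ S x = z.

(* Main.v *)
Require Import Defs.
From mathcomp Require Import all_boot.
From Stdlib Require Import FunctionalExtensionality.

(** The preimages of a sequence [y] under the shift are exactly the sequences
    [a y] obtained by putting one letter [a] in front.  Suppose the code of [y]
    is the shift of [z].  Since the code commutes with the shift, the code of
    [a y] agrees with [z] at every positive position, whatever [a] is, so the
    only remaining constraint is at position [0]: the block map must send [a]
    followed by the first [n] letters of [y] to [z 0]
    ([code_scons_eq]).  Hence *-commuting says that each such equation in [a]
    has exactly one solution, which is left permutivity.  In the converse
    direction every word [w] occurs as the beginning of some [y], and
    injectivity suffices because the alphabet is finite. *)

Definition scons {A : Type} (a : A) (y : nat -> A) : nat -> A :=
  fun i => if i is k.+1 then y k else a.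

Definition prefix_tuple {A : Type} (n : nat) (y : nat -> A) : n.-tuple A :=
  [tuple y j | j < n].

Lemma shiftE (A : Type) (x y : nat -> A) : shift x = y -> x = scons (x 0) y.
Proof. by move=> <-; apply: functional_extensionality; case. Qed.

Lemma code_shift (A : Type) (n : nat) (d : n.-tuple A -> A) (x : nat -> A) :
  sliding_block_code d (shift x) = shift (sliding_block_code d x).
Proof. by []. Qed.

Lemma code_scons0 (A : Type) (n : nat) (d : n.+1.-tuple A -> A) a y :
  sliding_block_code d (scons a y) 0 = d [tuple of a :: prefix_tuple n y].
Proof.
congr d; apply: eq_from_tnth => i; rewrite tnth_mktuple add0n.
by case: (unliftP ord0 i) => [j|] ->; rewrite ?tnth0 // tnthS tnth_mktuple.
Qed.

(** The hypothesis already forces agreement at all positive positions, which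
    turns an equation between sequences into an equation between letters. *)
Lemma code_scons_eq (A : Type) (n : nat) (d : n.+1.-tuple A -> A) a y z :
  sliding_block_code d y = shift z ->
  sliding_block_code d (scons a y) = z <->
  d [tuple of a :: prefix_tuple n y] = z 0.
Proof.
move=> yz; rewrite -code_scons0; split=> [-> //|z0].
apply: functional_extensionality => -[//|i].
exact: (congr1 (fun u => u i) yz).
Qed.

Lemma prefix_tuple_nth (A : Type) (n : nat) (a : A) (w : n.-tuple A) :
  prefix_tuple n (nth a w) = w.
Proof. by apply: eq_from_tnth => i; rewrite tnth_mktuple -tnth_nth. Qed.

Lemma left_permutive_star_commute (A : Type) (n : nat)
    (d : n.+1.-tuple A -> A) :
  left_permutive d -> star_commute (sliding_block_code d) (@shift A).
Proof.
move=> dP; split=> [x | y z yz]; first exact: code_shift.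
have [g dK gK] := dP (prefix_tuple n y).
exists (scons (g (z 0)) y); split.
  by split=> //; apply/(code_scons_eq _ _ _ _ _ _ yz); apply: gK.
move=> x [/shiftE -> /(code_scons_eq _ _ _ _ _ _ yz) <-].
by rewrite dK.
Qed.

Lemma star_commute_left_permutive (A : finType) (n : nat)
    (d : n.+1.-tuple A -> A) :
  star_commute (sliding_block_code d) (@shift A) -> left_permutive d.
Proof.
move=> [_ dP] w; apply: injF_bij => a b /= dab.
(* Two letters with the same image give two solutions over one pair [(y, z)];
   in [y], [a] is the default letter continuing [w] to an infinite sequence. *)
pose y := nth a w; pose z := sliding_block_code d (scons a y).
have yz : sliding_block_code d y = shift z by exact: code_shift.
have [x [_ xP]] := dP y z yz.
have xa : x = scons a y by apply: xP.
have xb : x = scons b y.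
  apply: xP; split=> //; apply/(code_scons_eq _ _ _ _ _ _ yz).
  by rewrite /z code_scons0 prefix_tuple_nth.
by rewrite xa in xb; apply: (congr1 (fun u => u 0) xb).
Qed.

Theorem theorem4p5 (A : finType) (n : nat) (d : n.+1.-tuple A -> A) :
  left_permutive d <-> star_commute (sliding_block_code d) (@shift A).
Proof.
split; first exact: left_permutive_star_commute.
exact: star_commute_left_permutive.
Qed.
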